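(* Let $\frac a{r_a},\frac b{r_b},\frac c{r_c}$ be the fractions of Wahl-2 chains. We have $\frac c{r_c}=\left[\frac a{r_a},4,\frac b{r_b}\right]$ if and only if $(a,b<c)$ is a Markov triple.
   Context: A Markov triple is a positive integer solution of $x^2+y^2+z^2=3xyz$; ''$(a,b<c)$ is a Markov triple'' means that $(a,b,c)$ is a Markov triple with $a,b<c$. The Hirzebruch-Jung continued fraction is $[e_1,\dots,e_r]=e_1-\cfrac1{e_2-\cfrac1{\ddots-\cfrac1{e_r}}}$; each rational number $>1$ is uniquely $[e_1,\dots,e_r]$ with all $e_i\ge2$, called its chain. A Wahl-2 chain is the chain of $\frac mr$ where $0<r<m$ are integers with $r^2\equiv-1\pmod m$. In $\left[\frac a{r_a},4,\frac b{r_b}\right]$ the fractions stand for their chains: if $\frac a{r_a}=[x_1,\dots,x_p]$ and $\frac b{r_b}=[y_1,\dots,y_q]$, it means $[x_1,\dots,x_p,4,y_1,\dots,y_q]$. The statement uses the notation of weights of a Markov triple: for a Markov triple $(a<b<c)$ and $x\in\{a,b,c\}$, the weights (characteristic numbers) are the integers $0<r_x<x$ with $r_a\equiv b^{-1}c\pmod a$, $r_b\equiv c^{-1}a\pmod b$, $r_c\equiv a^{-1}b\pmod c$; they satisfy $r_x^2\equiv-1\pmod x$ for $x>1$.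
   Formalization: For arbitrary Wahl-2 fractions ''Markov triple implies equality'' fails (2/1, 5/2, c=29 gives 31/18), so the right side also says that r_a, r_b, r_c are the weights of the triple, by the displayed formulas in the order (a,b,c), also when b<a. *)

(* Defs.v *)
From mathcomp Require Import all_boot all_order all_algebra.
From mathcomp Require Import zify ring lra.

Set Implicit Arguments.
Unset Strict Implicit.
Unset Printing Implicit Defensive.

Import Order.TTheory GRing.Theory Num.Theory.

Local Open Scope nat_scope.

(* Since 0^-1 = 0 in rat, the value 0 on [::] gives hj [:: x] = x.  When all
   entries are at least 2, every nonempty tail has a value > 1, so no other
   division by zero occurs. *)
Fixpoint hj (e : seq nat) : rat :=
  if e is x :: e' then (x%:R - (hj e')^-1)%R else 0%R.

Definition qfrac (m r : nat) : rat := (m%:R / r%:R)%R.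

(* [hj_chain e q]: e is the chain of the rational number q > 1. *)
Definition hj_chain (e : seq nat) (q : rat) : Prop :=
  all (fun x => 2 <= x) e /\ hj e = q.

(* [wahl2 m r]: the chain of m / r is a Wahl-2 chain. *)
Definition wahl2 (m r : nat) : Prop := 0 < r < m /\ m %| r ^ 2 + 1.

Definition markov (x y z : nat) : Prop :=
  [/\ 0 < x, 0 < y, 0 < z & x ^ 2 + y ^ 2 + z ^ 2 = 3 * x * y * z].

Definition markov_lt (a b c : nat) : Prop := [/\ markov a b c, a < c & b < c].

(* [is_weight m u v r]: 0 < r < m and r = u^-1 * v modulo m, where u' is an
   inverse of u modulo m. *)
Definition is_weight (m u v r : nat) : Prop :=
  0 < r < m /\ exists2 u', u * u' = 1 %[mod m] & r = u' * v %[mod m].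

(* The cyclic formulas make sense for a < b and for b < a alike; exchanging a
   and b replaces each weight r of x by x - r. *)
Definition weights (a b c ra rb rc : nat) : Prop :=
  [/\ is_weight a b c ra, is_weight b c a rb & is_weight c a b rc].

Section ChainExistsUnique.
Local Open Scope ring_scope.

Lemma hj_gt1 (x : nat) (e : seq nat) :
  all (fun x => 2 <= x)%N (x :: e) -> 1 < hj (x :: e).
Proof.
elim: e x => [|y e IH] x; first by rewrite /= andbT invr0 subr0 (ltr_nat _ 1).
move=> /andP[x2 /IH]; rewrite [hj (x :: _)]/=; set q := x%:R - _.
rewrite -/(hj (y :: e)) in q * => q1.
have : (2 : rat) <= x%:R by rewrite (ler_nat _ 2).
have : (hj (y :: e))^-1 < 1 by rewrite invf_lt1 // (lt_trans _ q1).
by rewrite /q; lra.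
Qed.

Lemma hj_tail (e : seq nat) : all (fun x => 2 <= x)%N e ->
  0 <= (hj e)^-1 < 1 /\ ((hj e)^-1 = 0 -> e = [::]).
Proof.
case: e => [_|x e /hj_gt1 q1]; first by rewrite /= invr0.
have q0 : 0 < hj (x :: e) by apply: lt_trans q1.
split; first by rewrite invr_ge0 ltW //= invf_lt1.
by move/eqP; rewrite invr_eq0 gt_eqF.
Qed.

Lemma hj_chain_unique (e1 e2 : seq nat) (q : rat) :
  hj_chain e1 q -> hj_chain e2 q -> e1 = e2.
Proof.
move=> [a1 <-] [a2 /esym]; elim: e1 e2 a1 a2 => [|x e1 IH] [|y e2] //.
- by move=> _ /hj_gt1 + q0; rewrite -q0.
- by move=> /hj_gt1 + _ q0; rewrite q0.
move=> /andP[_ a1] /andP[_ a2] /= q12.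
have [/andP[s0 s1] _] := hj_tail a1; have [/andP[t0 t1] _] := hj_tail a2.
have xy : x = y.
  have lt1 (k l : nat) (s t : rat) : s < 1 -> 0 <= t ->
      k%:R - s = l%:R - t -> (k < l.+1)%N.
    by rewrite -(ltr_nat rat) -natr1; lra.
  apply/eqP; rewrite eqn_leq -ltnS (lt1 _ _ _ _ s1 t0 q12) /=.
  by rewrite -ltnS (lt1 _ _ _ _ t1 s0 (esym q12)).
congr (_ :: _) => //; apply: IH => //.
by apply: invr_inj; move: q12; rewrite xy => /addrI/oppr_inj.
Qed.

Lemma hj_chain_exists (m r : nat) :
  (0 < r < m)%N -> exists e, hj_chain e (qfrac m r).
Proof.
have [n] := ubnP r; elim: n m r => // n IH m r rn /andP[r0 rm].
have r0' : (r%:R : rat) != 0 by rewrite pnatr_eq0 -lt0n.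
have [/dvdnP[k mE]|ndiv] := boolP (r %| m)%N.
  exists [:: k]; split; first by rewrite /= andbT -(ltn_pmul2r r0) mul1n -mE.
  by rewrite /= invr0 subr0 /qfrac mE natrM mulfK.
have s0 : (0 < m %% r)%N by rewrite lt0n.
have sr := ltn_pmod m r0; have mE := divn_eq m r.
have k0 : (0 < m %/ r)%N by rewrite divn_gt0 // ltnW.
have [||e [e2 eE]] := IH r (r - m %% r)%N; [lia|lia|].
exists ((m %/ r).+1 :: e); split; first by rewrite /= e2 andbT.
have mR : (m%:R : rat) = (m %/ r)%:R * r%:R + (m %% r)%:R.
  by rewrite -natrM -natrD -mE.
rewrite /= eE /qfrac invf_div natrB 1?ltnW // mR -natr1.
by field.
Qed.

End ChainExistsUnique.

(* Main.v *)
Require Import Defs.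
From mathcomp Require Import all_boot all_order all_algebra.
From mathcomp Require Import zify ring lra.

Import Order.TTheory GRing.Theory Num.Theory.

Local Open Scope nat_scope.

(** Prefixing an entry x to a chain of value v gives the value x - 1 / v: the
    Moebius map of [[x, -1], [1, 0]], of determinant 1.  In the coordinate
    u = v - 1, a chain of value m / r placed in front of a chain of value v
    produces (m u + s) / (r u + t) with m t - s r = 1 and 0 < s <= m, and these
    bounds determine s: it is the residue of - r^-1 modulo m.  So r^2 = -1
    modulo m says exactly that the matrix [[m, s], [r, t]] is symmetric
    ([symmetric_of_det1], [hj_cat_wahl2]).

    Let [[a, ra], [ra, k]] and [[b, rb], [rb, l]] be the symmetric matrices
    of the two given chains, and put p = 3 b - rb, q = 3 rb - l.  With an
    entry 4 between them, the product of the matrices is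

      [[a p + ra b, a q + ra rb], [ra p + k b, ra q + k rb]].

    Its first column is coprime, hence c / rc is the value of the glued chain
    if and only if c = a p + ra b and rc = ra p + k b ([hj_cat4],
    [qfrac_inj]).

    If these hold, then rc^2 = -1 modulo c makes the product symmetric, and
    the equality of its off-diagonal entries is the Markov equation for
    (a, b, c) divided by a b ([markov_of_cat4_symmetric]).  The same equality
    modulo gcd(a, b), with a parity argument, makes a and b coprime
    ([coprime_of_cat4_symmetric]), and the three
    congruences of the weights are read off the formulas for c and rc
    ([cat4_weights]).

    Conversely, for a Markov triple with these weights the congruences modulo
    a and modulo b force c = a p + ra b modulo a b, while the Markov equation
    makes the difference of the two sides less than a b ([markov_cat4_dist]);
    then a rc = b modulo c identifies rc ([cat4_of_markov]). *)

(** * Residues and reduced fractions *)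

Lemma coprime_Bezout (m n u v : nat) : m * u = v * n + 1 -> coprime m n.
Proof.
move=> E; rewrite /coprime -dvdn1 -(dvdn_addr (m := v * n)).
  by rewrite -E dvdn_mulr ?dvdn_gcdl.
by rewrite dvdn_mull ?dvdn_gcdr.
Qed.

Lemma dvdn_sqr1_coprime (m r : nat) : m %| r ^ 2 + 1 -> coprime m r.
Proof.
by case/dvdnP=> k E; apply: (@coprime_Bezout m r k r); rewrite mulnC -E mulnn.
Qed.

Lemma qfrac_inj (m r n s : nat) : coprime m r -> coprime n s ->
  0 < r -> 0 < s -> qfrac m r = qfrac n s -> m = n /\ r = s.
Proof.
move=> cmr cns r0 s0 /eqP.
rewrite /qfrac eqr_div ?pnatr_eq0 -?lt0n // -!natrM eqr_nat => /eqP E.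
have rs : r = s.
  apply/eqP; rewrite eqn_dvd -(Gauss_dvdr s (n := m)) ?E ?dvdn_mull 1?coprime_sym //=.
  by rewrite -(Gauss_dvdr r (n := n)) 1?coprime_sym // -E dvdn_mull.
by split=> //; apply/eqP; rewrite -(eqn_pmul2r s0) E rs.
Qed.

Lemma modn_inj_dist (d m n : nat) :
  m = n %[mod d] -> m < n + d -> n < m + d -> m = n.
Proof.
wlog le_mn : m n / m <= n => [IH E mn nm|E _ nm].
  by case: (leqP m n) => [|/ltnW] le; [apply: IH | apply/esym/IH].
have: d %| n - m by rewrite -eqn_mod_dvd // E.
have [e0|lt] := posnP (n - m); first by lia.
by move/(dvdn_leq lt); lia.
Qed.

Lemma modn_mul2l_inj (d p m n : nat) : coprime d p ->
  p * m = p * n %[mod d] -> m = n %[mod d].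
Proof.
move=> cdp; wlog le_nm : m n / n <= m => [IH E|].
  by case: (leqP n m) => [|/ltnW] le; [apply: IH | apply/esym/IH].
move/eqP; rewrite eqn_mod_dvd ?leq_mul // -mulnBr Gauss_dvdr //.
by rewrite -eqn_mod_dvd // => /eqP.
Qed.

(** Modulo m the determinant says s r = -1 = r^2, and r is invertible, so
    s = r modulo m; both lie between 1 and m, and r < m. *)
Lemma symmetric_of_det1 (m r s t : nat) : m * t = s * r + 1 ->
  m %| r ^ 2 + 1 -> 0 < r < m -> 0 < s <= m -> s = r.
Proof.
move=> E dv rm sm; apply: (@modn_inj_dist m); [|lia|lia].
apply: (@modn_mul2l_inj m r); first exact: dvdn_sqr1_coprime.
apply/eqP; rewrite -(eqn_modDr 1) [r * s]mulnC -E mulnn.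
by rewrite modnMr eq_sym -/(m %| _).
Qed.

(** * The action of a chain on a continued fraction *)

Section Moebius.
Local Open Scope ring_scope.

(** An entry x replaces (n, d) by (x n - d, n) and (s, t) by (x s - t, s).
    Since x >= 2, both sequences grow: d < n and t <= s persist, and
    s + d <= n + t, which says that (n - s, d - t) grows as well, keeps s <= n.
    Hence no subtraction is truncated, and since hj zs - 1 > 0 no denominator
    vanishes.  The equality for hj xs is the limit case of an infinite hj zs,
    in agreement with the convention 0^-1 = 0. *)
Lemma hj_cat (xs : seq nat) : all (fun x => 2 <= x)%N xs ->
  exists n s d t : nat,
    [/\ (n * t = s * d + 1)%N, (d < n)%N,
        [&& 0 < t, t <= s & s <= n]%N /\ (s + d <= n + t)%N,
        hj xs = n%:R / d%:R &
        forall zs, 1 < hj zs -> hj (xs ++ zs) =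
          (n%:R * (hj zs - 1) + s%:R) / (d%:R * (hj zs - 1) + t%:R)].
Proof.
elim: xs => [_|x e IH /andP[x2 /IH]] /=.
  by exists 1%N, 1%N, 0%N, 1%N; split=> //= zs _; field.
move=> [n [s [d [t [det dn [/and3P[t0 ts sn] sd] He Hz]]]]].
exists (x * n - d)%N, (x * s - t)%N, n, s.
have dxn : (d <= x * n)%N by nia.
have txs : (t <= x * s)%N by nia.
have n0 : (n%:R : rat) != 0 by rewrite pnatr_eq0; lia.
split=> //; [nia|nia|split; nia| |].
  by rewrite He invf_div natrB // natrM; field.
move=> zs z1; rewrite Hz // invf_div !natrB // !natrM.
have n0' : (0 : rat) < n%:R by rewrite ltr0n; lia.
have s0' : (0 : rat) < s%:R by rewrite ltr0n; lia.
by field; rewrite gt_eqF // addr_gt0 // mulr_gt0 // subr_gt0.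
Qed.

Lemma hj_cat_wahl2 (m r k : nat) (xs zs : seq nat) :
  (0 < r < m)%N -> (m * k = r ^ 2 + 1)%N -> hj_chain xs (qfrac m r) ->
  1 < hj zs ->
  hj (xs ++ zs) =
    (m%:R * (hj zs - 1) + r%:R) / (r%:R * (hj zs - 1) + k%:R).
Proof.
move=> rm mk [xs2 vxs] z1.
have dv : (m %| r ^ 2 + 1)%N by rewrite -mk dvdn_mulr.
have [n [s [d [t [det dn [t0 sd] He Hz]]]]] := hj_cat _ xs2.
have d0 : (0 < d)%N.
  rewrite lt0n; apply/eqP => d0; move: vxs; rewrite He d0 mulr0n invr0 mulr0 /qfrac.
  by move/esym/eqP; rewrite mulf_eq0 invr_eq0 !pnatr_eq0; lia.
have [||//||mn rd] := @qfrac_inj n d m r (@coprime_Bezout _ _ _ _ det).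
- exact: dvdn_sqr1_coprime.
- by [].
- by lia.
- by rewrite -vxs He.
subst n d; have sr : s = r by apply: (@symmetric_of_det1 m r s t) => //; lia.
subst s; have tk : t = k by apply/eqP; rewrite -(@eqn_pmul2l m); lia.
by rewrite Hz // tk.
Qed.

(** The entry 4 contributes hj (4 :: ys) - 1 = 3 - rb / b = (3 b - rb) / b. *)
Lemma hj_cat4 (a ra k b rb : nat) (xs ys : seq nat) :
  (0 < ra < a)%N -> (a * k = ra ^ 2 + 1)%N -> (0 < rb < b)%N ->
  hj_chain xs (qfrac a ra) -> hj_chain ys (qfrac b rb) ->
  hj (xs ++ 4 :: ys) =
    qfrac (a * (3 * b - rb) + ra * b) (ra * (3 * b - rb) + k * b).
Proof.
move=> ram ak rbm hx [y2 hy].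
have b0 : (0 : rat) < b%:R by rewrite ltr0n; lia.
have rb0 : (0 : rat) < rb%:R by rewrite ltr0n; lia.
have rbb : (rb%:R : rat) < b%:R by rewrite ltr_nat; lia.
have ra0 : (0 : rat) < ra%:R by rewrite ltr0n; lia.
have k0 : (0 : rat) < k%:R by rewrite ltr0n; nia.
rewrite (hj_cat_wahl2 _ _ _ _ _ ram ak hx); last by apply: hj_gt1; rewrite /= y2.
rewrite /= hy /qfrac invf_div !natrD !natrM natrB ?natrM; last by lia.
field; rewrite !gt_eqF // addr_gt0 // mulr_gt0 //; lra.
Qed.

End Moebius.

(** * Weights *)

Lemma is_weightP (m u v r : nat) : is_weight m u v r <->
  [/\ 0 < r < m, coprime m u & u * r = v %[mod m]].
Proof.
split=> [[rm [w uw rE]]|[rm cmu urE]].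
  split=> //; last by rewrite -modnMmr rE modnMmr mulnA -modnMml uw modnMml mul1n.
  have: coprime m (u * w) by rewrite -coprime_modr uw coprime_modr coprimen1.
  by rewrite coprimeMr => /andP[].
have u0 : 0 < u by case: (u) cmu => //; rewrite /coprime gcdn0; lia.
move: cmu; rewrite coprime_sym => /(coprimeP _ u0)[[w x] /= wx].
have uw : u * w = 1 %[mod m].
  have -> : u * w = x * m + 1 by lia.
  by rewrite modnMDl.
split=> //; exists w => //.
by rewrite -modnMmr -urE modnMmr mulnA -modnMml [w * u]mulnC uw modnMml mul1n.
Qed.

(** * The Markov equation as symmetry of the glued chain *)

(** A square is never -1 modulo 4, so r^2 + 1 contains the prime 2 at most
    once. *)
Lemma odd_of_even_dvdn (a k r : nat) : (2 * a) * k = r ^ 2 + 1 ->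
  [/\ odd r, odd a & odd k].
Proof.
move=> E; have r1 : odd r.
  by have := congr1 odd E; rewrite -mulnA oddM oddD oddX /=; case: (odd r).
have := odd_double_half r; rewrite r1 => rE.
have /(congr1 odd) : a * k = 2 * (r./2 * (r./2 + 1)) + 1.
  by move: E; rewrite -rE -muln2; nia.
by rewrite oddD !oddM /= => /andP[].
Qed.

(** A common divisor g of a and b is prime to ra and rb.  With p = 3 b - rb the
    symmetry reads a q + 2 ra rb = (3 ra + k) b, so g divides 2.  If g = 2, then
    ra, rb, a / 2, b / 2, k and l are all odd and hence q is even; halving the
    last equality leaves an odd left side and an even right side. *)
Lemma coprime_of_cat4_symmetric (a ra k b rb l p q : nat) :
  a * k = ra ^ 2 + 1 -> b * l = rb ^ 2 + 1 ->
  p + rb = 3 * b -> q + l = 3 * rb ->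
  a * q + ra * rb = ra * p + k * b -> coprime a b.
Proof.
move=> ak bl pE qE sym; set g := gcdn a b.
have sym2 : a * q + 2 * (ra * rb) = (3 * ra + k) * b.
  by have := congr1 (muln ra) pE; lia.
have ca : coprime a ra by apply: dvdn_sqr1_coprime; rewrite -ak dvdn_mulr.
have cb : coprime b rb by apply: dvdn_sqr1_coprime; rewrite -bl dvdn_mulr.
have g2 : g %| 2.
  have: g %| 2 * (ra * rb).
    rewrite -(dvdn_addr (m := a * q)) ?dvdn_mulr ?dvdn_gcdl //.
    by rewrite sym2 dvdn_mull ?dvdn_gcdr.
  rewrite Gauss_dvdl // coprimeMr (coprime_dvdl (dvdn_gcdl a b) ca).
  by rewrite (coprime_dvdl (dvdn_gcdr a b) cb).
have /orP[//|/eqP gE] : (g == 1) || (g == 2).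
  by have := g2; rewrite dvdn_divisors // !inE.
have := dvdn_gcdl a b; have := dvdn_gcdr a b; rewrite -/g gE.
move=> /dvdnP[b' bE] /dvdnP[a' aE].
have [ra1 a'1 k1] : [/\ odd ra, odd a' & odd k].
  by apply: odd_of_even_dvdn; rewrite -ak aE [2 * _]mulnC.
have [rb1 b'1 l1] : [/\ odd rb, odd b' & odd l].
  by apply: odd_of_even_dvdn; rewrite -bl bE [2 * _]mulnC.
have /(congr1 odd) : a' * q + ra * rb = (3 * ra + k) * b'.
  by move: sym2; rewrite aE bE; lia.
have /(congr1 odd) := qE.
rewrite !(oddD, oddM) /= ra1 rb1 a'1 b'1 k1 l1 /=.
by case: (odd q).
Qed.

(** The determinant is multiplicative: a k - ra^2 = 1 multiplies
    p rb - q b = b l - rb^2 = 1. *)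
Lemma cat4_det (a ra k b rb l p q : nat) :
  a * k = ra ^ 2 + 1 -> b * l = rb ^ 2 + 1 ->
  p + rb = 3 * b -> q + l = 3 * rb ->
  (a * p + ra * b) * (ra * q + k * rb) =
  (a * q + ra * rb) * (ra * p + k * b) + 1.
Proof.
move=> ak bl pE qE.
have pq : p * rb = q * b + 1.
  by have := congr1 (muln rb) pE; have := congr1 (muln b) qE; lia.
set z := a * p * (ra * q) + ra * b * (k * rb).
have -> : (a * p + ra * b) * (ra * q + k * rb) =
    z + a * k * (p * rb) + ra ^ 2 * (q * b) by rewrite /z; ring.
have -> : (a * q + ra * rb) * (ra * p + k * b) =
    z + a * k * (q * b) + ra ^ 2 * (p * rb) by rewrite /z; ring.
by rewrite pq ak; ring.
Qed.

(** Writing a^2 = a^2 (b l - rb^2) and b^2 = b^2 (a k - ra^2), the difference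
    of the two sides becomes a b (ra p + k b - a q - ra rb). *)
Lemma markov_of_cat4_symmetric (a ra k b rb l p q : nat) :
  a * k = ra ^ 2 + 1 -> b * l = rb ^ 2 + 1 ->
  p + rb = 3 * b -> q + l = 3 * rb ->
  a * q + ra * rb = ra * p + k * b ->
  a ^ 2 + b ^ 2 + (a * p + ra * b) ^ 2 = 3 * a * b * (a * p + ra * b).
Proof.
move=> ak bl pE qE sym.
set c := a * p + ra * b.
(* Adding one side of each hypothesis, with the multiplier it has in the
   identity, keeps the computation free of truncated subtractions. *)
apply: (@addIn (a * c * (3 * b) + a ^ 2 * b * (3 * rb) +
  a ^ 2 * rb * (p + rb) + a * b * (a * q + ra * rb) + a ^ 2 * (b * l) +
  b ^ 2 * (a * k))).
transitivity (3 * a * b * c + (a * c * (p + rb) + a ^ 2 * b * (q + l) +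
  a ^ 2 * rb * (3 * b) + a * b * (ra * p + k * b) + a ^ 2 * (rb ^ 2 + 1) +
  b ^ 2 * (ra ^ 2 + 1))); first by rewrite /c; ring.
by rewrite pE qE sym ak bl.
Qed.

Lemma sqr1_quotient_le (b r l : nat) : 0 < r < b -> b * l = r ^ 2 + 1 -> l <= r.
Proof.
case/andP=> r0 rb bl; have b0 : 0 < b by apply: leq_trans rb.
by rewrite -(leq_pmul2l b0) bl -mulnn addn1 ltn_pmul2r.
Qed.

Lemma cat4_coprime (a ra k b rb l p : nat) : 0 < rb < b ->
  a * k = ra ^ 2 + 1 -> b * l = rb ^ 2 + 1 -> p + rb = 3 * b ->
  coprime (a * p + ra * b) (ra * p + k * b).
Proof.
move=> rbm ak bl pE; have l_le := sqr1_quotient_le _ _ _ rbm bl.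
have [q qE] : exists q, q + l = 3 * rb by exists (3 * rb - l); lia.
exact: coprime_Bezout (cat4_det _ _ _ _ _ _ _ _ ak bl pE qE).
Qed.

Lemma cat4_mul_den (a ra k b p : nat) : a * k = ra ^ 2 + 1 ->
  a * (ra * p + k * b) = ra * (a * p + ra * b) + b.
Proof.
move=> ak; have -> : a * (ra * p + k * b) = a * ra * p + a * k * b by ring.
by rewrite ak; ring.
Qed.

Lemma cat4_weights (a ra k b rb l p : nat) : 0 < ra < a -> 0 < rb < b ->
  a * k = ra ^ 2 + 1 -> b * l = rb ^ 2 + 1 -> p + rb = 3 * b ->
  let c := a * p + ra * b in let rc := ra * p + k * b in
  [/\ c = b * ra %[mod a], c * rb = a %[mod b] & a * rc = b %[mod c]].
Proof.
move=> ram rbm ak bl pE c rc; split.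
- by rewrite /c mulnC modnMDl mulnC.
- apply/eqP; rewrite -(eqn_modDr (a * rb ^ 2)); apply/eqP.
  have -> : c * rb + a * rb ^ 2 = (3 * a * rb + ra * rb) * b.
    by rewrite /c; have := congr1 (muln (a * rb)) pE; lia.
  have -> : a + a * rb ^ 2 = (a * l) * b by have := congr1 (muln a) bl; lia.
  by rewrite !modnMl.
- by rewrite cat4_mul_den // modnMDl.
Qed.

(** * Recognizing c and rc from a Markov triple *)

Lemma modn_sqr1 (b l r x : nat) : b * l = r ^ 2 + 1 ->
  x * r * r + x = 0 %[mod b].
Proof.
move=> bl; have -> : x * r * r + x = x * (r ^ 2 + 1) by ring.
by rewrite -bl mulnCA modnMr mod0n.
Qed.

(** With t = 3 a b - c the Markov equation reads c t = a^2 + b^2, so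
    0 < t < a + b because a, b < c.  The difference of a p + ra b and c is
    t + ra b - a rb, and |ra b - a rb| <= a b - a - b. *)
Lemma markov_cat4_dist (a ra b rb p c : nat) :
  0 < ra < a -> 0 < rb < b -> p + rb = 3 * b -> markov_lt a b c ->
  c < a * p + ra * b + a * b /\ a * p + ra * b < c + a * b.
Proof.
move=> ram rbm pE [[_ _ c_gt0 mE] ac bc].
have c0E : a * p + ra * b + a * rb = 3 * a * b + ra * b.
  transitivity (a * (p + rb) + ra * b); first by ring.
  by rewrite pE; ring.
have tE : c * (3 * a * b - c) = a ^ 2 + b ^ 2.
  by rewrite mulnBr [c * (_ * b)]mulnC -mE mulnn addnK.
have t_gt0 : 0 < 3 * a * b - c.
  by rewrite lt0n; apply/eqP => t0; move: tE; rewrite t0 muln0; lia.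
have t_lt : 3 * a * b - c < a + b.
  rewrite -(ltn_pmul2l c_gt0) tE mulnDr -!mulnn.
  by rewrite -addSn leq_add // ?ltn_pmul2r ?leq_pmul2r //; lia.
have arb : a <= a * rb <= a * b by rewrite leq_pmulr ?leq_mul2l; lia.
have rab : ra * b + b <= a * b by rewrite -mulSnr leq_mul2r; lia.
by move: c0E t_gt0 t_lt arb rab; rewrite -[3 * a * b]mulnA; lia.
Qed.

(** Both values are determined by congruences and size: c modulo a b by the
    Chinese remainder theorem, rc modulo c since a is invertible there. *)
Lemma cat4_of_markov (a ra k b rb l p c rc : nat) :
  0 < ra < a -> 0 < rb < b ->
  a * k = ra ^ 2 + 1 -> b * l = rb ^ 2 + 1 -> p + rb = 3 * b ->
  markov_lt a b c -> weights a b c ra rb rc ->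
  c = a * p + ra * b /\ rc = ra * p + k * b.
Proof.
move=> ram rbm ak bl pE mc; have [_ ac bc] := mc.
have [lt1 lt2] := markov_cat4_dist _ _ _ _ _ _ ram rbm pE mc.
have [ca' cb' crc'] := cat4_weights _ _ _ _ _ _ _ ram rbm ak bl pE.
case=> /is_weightP[_ cab ca] /is_weightP[_ _ cb] /is_weightP[rcm cca crc].
have cE : c = a * p + ra * b.
  apply: (@modn_inj_dist (a * b)) => //.
  apply/eqP; rewrite chinese_remainder // ca' ca eqxx /=.
  (* Modulo b, x rb^2 + x = 0 for every x, so c and a p + ra b agree once
     their products with rb do. *)
  rewrite -(eqn_modDl (c * rb * rb)) (modn_sqr1 _ _ _ _ bl).
  by rewrite -modnDml -modnMml cb -cb' modnMml modnDml (modn_sqr1 _ _ _ _ bl).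
split=> //; rewrite -cE in crc'.
have [/andP[_ ra_lt] /andP[_ rc_lt]] := (ram, rcm).
have den_lt : ra * p + k * b < c.
  have a0 : 0 < a by apply: leq_ltn_trans ra_lt.
  rewrite -(ltn_pmul2l a0) (cat4_mul_den _ _ _ _ _ ak) -cE.
  by apply: leq_trans (leq_mul ra_lt (leqnn c)); rewrite mulSnr ltn_add2l.
rewrite -[LHS](modn_small rc_lt) -[RHS](modn_small den_lt).
by apply: (@modn_mul2l_inj c a) => //; rewrite crc crc'.
Qed.

(** The divisibility of rc^2 + 1 by c makes the matrix of the glued chain
    symmetric; its upper right entry is at most c because q <= p. *)
Lemma markov_of_cat4 (a ra k b rb l p c rc : nat) :
  0 < ra < a -> 0 < rb < b -> 0 < rc < c -> c %| rc ^ 2 + 1 ->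
  a * k = ra ^ 2 + 1 -> b * l = rb ^ 2 + 1 -> p + rb = 3 * b ->
  c = a * p + ra * b -> rc = ra * p + k * b ->
  markov_lt a b c /\ weights a b c ra rb rc.
Proof.
move=> ram rbm rcm dv ak bl pE cE rcE.
have [/andP[ra0 _] /andP[rb0 rb_lt]] := (ram, rbm).
have b0 : 0 < b by apply: leq_trans rb_lt.
have a0 : 0 < a by lia.
have l_le := sqr1_quotient_le _ _ _ rbm bl.
have [q qE] : exists q, q + l = 3 * rb by exists (3 * rb - l); lia.
have bp : b < p by lia.
have p1 : 1 < p by apply: leq_ltn_trans bp.
have [ac bc] : a < c /\ b < c.
  rewrite cE; split; apply: leq_trans (leq_addr _ _).
    by rewrite ltn_Pmulr.
  exact: leq_trans bp (leq_pmull _ a0).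
have det := cat4_det _ _ _ _ _ _ _ _ ak bl pE qE.
have qp : q <= p.
  (* b (b + l) = b^2 + rb^2 + 1 > 2 b rb. *)
  have : 2 * rb <= b + l.
    rewrite -(leq_pmul2l b0) mulnDr bl mulnCA mulnn addnA addn1.
    by rewrite leqW // nat_Cauchy.
  by lia.
have sym : a * q + ra * rb = ra * p + k * b.
  rewrite -rcE; apply: (@symmetric_of_det1 c rc _ (ra * q + k * rb)) => //.
    by rewrite cE rcE.
  apply/andP; split; first by rewrite addn_gt0 orbC muln_gt0 ra0 rb0.
  by rewrite cE; apply: leq_add; apply: leq_mul => //; apply: ltnW.
have mE := markov_of_cat4_symmetric _ _ _ _ _ _ _ _ ak bl pE qE sym.
have cab := coprime_of_cat4_symmetric _ _ _ _ _ _ _ _ ak bl pE qE sym.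
have [ca cb crc] := cat4_weights _ _ _ _ _ _ _ ram rbm ak bl pE.
rewrite -cE -?rcE in mE ca cb crc.
have ca1 : coprime c a.
  rewrite coprime_sym -coprime_modr ca coprime_modr coprimeMr cab.
  by apply: dvdn_sqr1_coprime; rewrite -ak dvdn_mulr.
have cbc : coprime b c.
  have: coprime b (c * rb) by rewrite -coprime_modr cb coprime_modr coprime_sym.
  by rewrite coprimeMr => /andP[].
split; first by split=> //; split=> //; apply: ltn_trans bc.
by split; apply/is_weightP.
Qed.

Theorem theorem1p9 (a b c ra rb rc : nat) (xs ys : seq nat) :
  wahl2 a ra -> wahl2 b rb -> wahl2 c rc ->
  hj_chain xs (qfrac a ra) -> hj_chain ys (qfrac b rb) ->
  (qfrac c rc = hj (xs ++ 4 :: ys) <->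
   markov_lt a b c /\ weights a b c ra rb rc).
Proof.
move=> [ram /dvdnP[k ak]] [rbm /dvdnP[l bl]] [rcm dv] hx hy.
have {}ak : a * k = ra ^ 2 + 1 by rewrite mulnC.
have {}bl : b * l = rb ^ 2 + 1 by rewrite mulnC.
rewrite (hj_cat4 _ _ _ _ _ _ _ ram ak rbm hx hy).
have pE : 3 * b - rb + rb = 3 * b by lia.
split=> [E|[mc wc]]; last first.
  by have [-> ->] := cat4_of_markov _ _ _ _ _ _ _ _ _ ram rbm ak bl pE mc wc.
have [||||cE rcE] := qfrac_inj _ _ _ _ _ _ _ _ E.
- exact: dvdn_sqr1_coprime.
- exact: cat4_coprime rbm ak bl pE.
- by case/andP: rcm.
- by rewrite addn_gt0 muln_gt0; lia.
exact: markov_of_cat4 ram rbm rcm dv ak bl pE cE rcE.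
Qed.
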